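(* Let $G$ be a finite group having a chief series of length $r$. Then $G$ is non-solvable if and only if the $(r-1)$-skeleton of the order complex $\vert L(G)\vert$ is shellable and pure of dimension $r-1$.
   Context: $L(G)$ denotes the subgroup lattice of $G$ (all subgroups ordered by inclusion), with least element the trivial subgroup and greatest element $G$. The order complex $\vert L(G)\vert$ is the simplicial complex whose faces are the chains of $L(G)\setminus\{1,G\}$ (proper nontrivial subgroups). The $k$-skeleton of a simplicial complex is the subcomplex of faces of dimension at most $k$. A complex is pure if all facets (maximal faces) have the same dimension. A shelling is an ordering $\sigma_1,\dots,\sigma_m$ of the facets such that for each $i$ the intersection of $\sigma_i$ with the subcomplex generated by $\sigma_1,\dots,\sigma_{i-1}$ is pure of dimension $\dim\sigma_i-1$; a complex is shellable if it has a shelling.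
   Formalization: The group G is assumed nontrivial: for G = 1 (r = 0) the order complex has only the empty face, so its (-1)-skeleton is shellable and pure of dimension -1 although G is solvable, and the stated equivalence fails. *)

(* Defs.v *)
From HB Require Import structures.
From mathcomp Require Import all_boot all_order all_algebra all_fingroup all_solvable.

Set Implicit Arguments.
Unset Strict Implicit.
Unset Printing Implicit Defensive.

Import Order.TTheory GRing.Theory Num.Theory.

(* A finite simplicial complex on vertices in T is represented by its set of
   faces, a downward closed K : {set {set T}}.  The empty face is a face of
   every complex used here (dimension -1), so dimensions live in int. *)

Section SimplicialComplexes.
Variable T : finType.
Implicit Types (K : {set {set T}}) (s t : {set T}) (d k : int).

Definition sdim s : int := (#|s|%:Z - 1)%R.

Definition facets K : {set {set T}} := [set s | maxset [in K] s].

Definition skeleton k K : {set {set T}} := [set s in K | (sdim s <= k)%R].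

Definition pure_of_dim d K : Prop :=
  K != set0 /\ forall s, s \in facets K -> sdim s = d.

Definition generated (l : seq {set T}) : {set {set T}} :=
  [set t : {set T} | has (fun s => t \subset s) l].

(* The shelling condition starts at the second facet: nothing precedes the
   first one.  The complex K need not be pure. *)
Definition shelling K (l : seq {set T}) : Prop :=
  [/\ uniq l, l =i facets K
    & forall i : nat, 0 < i < size l ->
        let s := nth set0 l i in
        pure_of_dim (sdim s - 1)%R (powerset s :&: generated (take i l))].

Definition shellable K : Prop := exists l, shelling K l.

Definition order_complex (le : rel T) (P : {set T}) : {set {set T}} :=
  [set c in powerset P | [forall x in c, forall y in c, le x y || le y x]].

End SimplicialComplexes.

Section SubgroupLattice.
Variable gT : finGroupType.
Implicit Type G : {group gT}.

Definition subgroup_le : rel {group gT} := fun H K => H \subset K.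

Definition subgroup_complex G : {set {set {group gT}}} :=
  order_complex subgroup_le (subgroups G :\: [set 1%G; G]).

(* 1 = H_0 < H_1 < ... < H_r = G with chief factors H_(i+1) / H_i; the
   sequence s omits H_0, so its size is the length of the series. *)
Definition has_chief_series G (r : nat) : Prop :=
  exists s : seq {group gT},
    [/\ (G.-chief).-series%g 1%G s, last 1%G s = G & size s = r].

End SubgroupLattice.

(* Main.v *)
(* Let N_0 < ... < N_r be a chief series of G.  A pair A < B jumps over the
   index i when A N_i :&: B <> A N_(i+1) :&: B; a step of a saturated chain jumps
   at most once, so every saturated chain from A to B has at least as many steps
   as there are jumps from A to B.  Since normal subgroups are modular elements of
   the subgroup lattice, shedding the subgroups incomparable to A N_i :&: B shows
   by induction that the open interval (A, B) has a shellable skeleton whose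
   facets have (number of jumps) - 1 elements, and one element more if no
   saturated chain attains the lower bound.

   For (1, G) the number of jumps is r.  If G has a saturated chain of length r,
   then each factor N_(i+1) / N_i is complemented by a maximal subgroup; inductively
   this complement is solvable, and a coprime action argument shows that the factor
   is solvable too.  So for non-solvable G the bound is not attained and the
   (r - 1)-skeleton is shellable.  Conversely a solvable group has a saturated chain
   of length at most r (Kohler), which is a facet of too small a dimension. *)
Require Import Defs.
From HB Require Import structures.
From mathcomp Require Import all_boot all_order all_algebra all_fingroup all_solvable.
From mathcomp Require Import zify.

Set Implicit Arguments.
Unset Strict Implicit.
Unset Printing Implicit Defensive.

(** * Vertex decomposable skeleta of clique complexes *)

Section CliqueComplexes.

Variables (T : finType) (e : rel T).
Hypotheses (e_refl : reflexive e) (e_sym : symmetric e).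
Implicit Types (P Q W I c : {set T}) (v w x y z : T) (k : nat).

Definition clique P := {in P &, forall x y, e x y}.

Definition link P v : {set T} := [set x in P :\ v | e v x].

(* [skel_dec P k] is a recursive certificate that the skeleton of the clique
   complex of [P] spanned by the cliques of size at most [k] is pure and vertex
   decomposable; [k] counts vertices, so the dimension is [k - 1]. *)
Inductive skel_dec : {set T} -> nat -> Prop :=
| SkelDec0 P : skel_dec P 0
| SkelDecClique P : clique P -> skel_dec P #|P|
| SkelDecVertex P v k : v \in P ->
    skel_dec (P :\ v) k.+1 -> skel_dec (link P v) k -> skel_dec P k.+1.

Lemma link_sub P v : link P v \subset P :\ v.
Proof. by apply/subsetP=> x; rewrite inE => /andP[]. Qed.

(** In a clique the link of [v] is the same set as its deletion, so both branches recurse on one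
    smaller clique. *)
Lemma skel_dec_clique P k : clique P -> k <= #|P| -> skel_dec P k.
Proof.
elim: {P}#|P| {-2}P (leqnn #|P|) k => [|n IHn] P leP k clP.
  by move=> /leq_trans/(_ leP); rewrite leqn0 => /eqP->; apply: SkelDec0.
rewrite leq_eqVlt => /predU1P[->|lt_k_P]; first exact: SkelDecClique.
case: k lt_k_P => [|k] ltkP; first exact: SkelDec0.
have /card_gt0P[v Pv] : 0 < #|P| by apply: leq_trans ltkP.
have cD : #|P| = #|P :\ v|.+1 by rewrite (cardsD1 v) Pv.
have clD : clique (P :\ v).
  by move=> x y /setD1P[_ Px] /setD1P[_ Py]; apply: clP.
have linkE : link P v = P :\ v.
  apply/setP=> x; rewrite inE; apply: andb_idr => /setD1P[_ Px]; exact: clP.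
by apply: (SkelDecVertex Pv); rewrite ?linkE; apply: IHn => //; lia.
Qed.

Lemma skel_decS P k : skel_dec P k.+1 -> skel_dec P k.
Proof.
move: {1 3}k.+1 (erefl k.+1) => m Em SP; elim: SP k Em => {P m}.
- by [].
- by move=> P clP k Ek; apply: skel_dec_clique => //; lia.
move=> P v k Pv _ IH1 _ IH2 _ [<-]; case: k IH1 IH2 => [|k] IH1 IH2.
  exact: SkelDec0.
by apply: (SkelDecVertex Pv); [apply: IH1 | apply: IH2].
Qed.

Lemma skel_dec_leq P k m : m <= k -> skel_dec P k -> skel_dec P m.
Proof.
move=> /subnKC <-; elim: (k - m) => [|j IHj]; first by rewrite addn0.
by rewrite addnS => /skel_decS/IHj.
Qed.

Lemma skel_dec1 P : P != set0 -> skel_dec P 1.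
Proof.
elim: {P}#|P| {-2}P (leqnn #|P|) => [|n IHn] P leP ntP.
  by move: leP; rewrite leqn0 cards_eq0 (negPf ntP).
have /set0Pn[v Pv] := ntP; have [D0|] := eqVneq (P :\ v) set0.
  apply: skel_dec_clique; last by rewrite card_gt0.
  have sub1 x : x \in P -> x = v.
    by move=> Px; apply: contra_eq D0 => nxv; apply/set0Pn; exists x; apply/setD1P.
  by move=> x y /sub1-> /sub1->.
move=> ntD; apply: (SkelDecVertex Pv); last exact: SkelDec0.
by apply: IHn ntD; rewrite (cardsD1 v) Pv in leP.
Qed.

(** * Joins, cones and successive shedding *)

Definition joined P Q := forall x y, x \in P -> y \in Q -> (x != y) && e x y.

Lemma joined_sym P Q : joined P Q -> joined Q P.
Proof. by move=> jPQ x y Qx Py; rewrite eq_sym e_sym jPQ. Qed.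

Lemma joinedS P P' Q : P' \subset P -> joined P Q -> joined P' Q.
Proof. by move=> /subsetP sP jPQ x y /sP; apply: jPQ. Qed.

Lemma joined_setD1 P Q v : joined P Q -> v \in P -> (P :|: Q) :\ v = P :\ v :|: Q.
Proof.
move=> jPQ Pv; apply/setP=> x; rewrite !inE.
by have [->|//] := eqVneq; case Qv: (v \in Q) => //; have:= jPQ _ _ Pv Qv; rewrite eqxx.
Qed.

Lemma joined_link P Q v : joined P Q -> v \in P -> link (P :|: Q) v = link P v :|: Q.
Proof.
move=> jPQ Pv; rewrite /link joined_setD1 //; apply/setP=> x; rewrite !inE andb_orl.
by case Qx: (x \in Q); rewrite //= (andP (jPQ _ _ Pv Qx)).2.
Qed.

Lemma skel_dec_join0 P Q l : joined P Q -> skel_dec Q l -> skel_dec (P :|: Q) l.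
Proof.
elim: {P}#|P| {-2}P (leqnn #|P|) Q l => [|n IHn] P leP Q l jPQ SQ.
  by move: leP; rewrite leqn0 cards_eq0 => /eqP->; rewrite set0U.
have [->|/set0Pn[v Pv]] := eqVneq P set0; first by rewrite set0U.
case: l SQ => [|l] SQ; first exact: SkelDec0.
have leD : #|P :\ v| <= n by rewrite (cardsD1 v) Pv in leP.
apply: (@SkelDecVertex _ v); first by rewrite inE Pv.
  by rewrite joined_setD1 //; apply: IHn => //; apply: joinedS jPQ; apply: subD1set.
rewrite joined_link //; apply: IHn (skel_decS SQ).
  exact: leq_trans (subset_leq_card (link_sub _ _)) leD.
by apply: joinedS jPQ; apply: subset_trans (link_sub _ _) (subD1set _ _).
Qed.

(** Deletion and link of a vertex of one factor commute with the join, so the certificate of [P] is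
    replayed first, then that of [Q] once [P] is a clique. *)
Lemma skel_dec_join P Q k l :
  joined P Q -> skel_dec P k -> skel_dec Q l -> skel_dec (P :|: Q) (k + l).
Proof.
move=> jPQ SP; elim: SP Q l jPQ => {P k}.
- by move=> P Q l jPQ; apply: skel_dec_join0.
- move=> P clP Q l jPQ SQ; elim: SQ jPQ => {Q l}.
  + move=> Q jPQ; rewrite addn0 setUC; apply: skel_dec_join0 (joined_sym jPQ) _.
    exact: SkelDecClique.
  + move=> Q clQ jPQ; have -> : #|P| + #|Q| = #|P :|: Q|.
      rewrite cardsU (_ : P :&: Q = set0) ?cards0 ?subn0 //.
      apply/setP=> x; rewrite !inE; apply/negP=> /andP[Px Qx].
      by have:= jPQ _ _ Px Qx; rewrite eqxx.
    apply: SkelDecClique => x y; rewrite !inE => /orP[Px|Qx] /orP[Py|Qy].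
    * exact: clP.
    * exact: (andP (jPQ _ _ Px Qy)).2.
    * by rewrite e_sym (andP (jPQ _ _ Py Qx)).2.
    * exact: clQ.
  move=> Q v k Qv _ IH1 _ IH2 jPQ; have jQP := joined_sym jPQ.
  rewrite addnS; apply: (@SkelDecVertex _ v); first by rewrite inE Qv orbT.
    rewrite setUC joined_setD1 // setUC -addnS; apply: IH1.
    by apply: joined_sym; apply: joinedS jQP; apply: subD1set.
  rewrite setUC joined_link // setUC; apply: IH2.
  by apply: joined_sym; apply: joinedS jQP; apply: subset_trans (link_sub _ _) (subD1set _ _).
move=> P v k Pv _ IH1 _ IH2 Q l jPQ SQ.
rewrite addSn; apply: (@SkelDecVertex _ v); first by rewrite inE Pv.
  by rewrite joined_setD1 // -addSn; apply: IH1 SQ; apply: joinedS jPQ; apply: subD1set.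
rewrite joined_link //; apply: IH2 SQ.
by apply: joinedS jPQ; apply: subset_trans (link_sub _ _) (subD1set _ _).
Qed.

Lemma skel_dec_cone P v k :
  joined [set v] P -> skel_dec P k -> skel_dec (v |: P) k.+1.
Proof.
move=> jvP SP; rewrite -[k.+1]add1n; apply: skel_dec_join => //.
by apply: skel_dec1; apply/set0Pn; exists v; rewrite set11.
Qed.

(** The vertices of [I] are shed by decreasing [key]. Vertices of equal key are not adjacent, so the
    link of [z] consists of neighbours in [W] or of smaller key. *)
Lemma skel_dec_extend W I (key : T -> nat) k :
    [disjoint W & I] ->
    {in I &, forall w z, w != z -> key w = key z -> ~~ e z w} ->
    {in I, forall z,
      skel_dec [set w in W :|: [set y in I | key y < key z] | e z w] k} ->
  skel_dec W k.+1 -> skel_dec (W :|: I) k.+1.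
Proof.
elim: {I}#|I| {-2}I (leqnn #|I|) => [|n IHn] I leI dWI keyI linkI SW.
  by move: leI; rewrite leqn0 cards_eq0 => /eqP->; rewrite setU0.
have [->|/set0Pn[z0 Iz0]] := eqVneq I set0; first by rewrite setU0.
case: (@arg_maxnP _ z0 (mem I) key Iz0) => z Iz max_z.
have {}Iz : z \in I := Iz.
have {}max_z y : y \in I -> key y <= key z := max_z y.
have zW : z \notin W.
  by apply/negP=> Wz; move/pred0P: dWI => /(_ z); rewrite /= Wz Iz.
have DE : (W :|: I) :\ z = W :|: I :\ z.
  apply/setP=> x; rewrite !inE; have [->|//] := eqVneq.
  by rewrite (negPf zW).
apply: (@SkelDecVertex _ z); first by rewrite inE Iz orbT.
  rewrite DE; apply: IHn => //.
  - by rewrite (cardsD1 z) Iz in leI.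
  - by apply: disjointWr dWI; apply: subD1set.
  - by move=> w y /setD1P[_ Iw] /setD1P[_ Iy]; apply: keyI.
  move=> y /setD1P[_ Iy].
  rewrite [X in skel_dec X _](_ : _ = [set w in W :|: [set y' in I | key y' < key y] | e y w]).
    exact: linkI.
  apply/setP=> w; rewrite !inE; have [->|//] := eqVneq.
  by rewrite [key z < _]ltnNge (max_z _ Iy) !andbF.
rewrite [X in skel_dec X _](_ : _ = [set w in W :|: [set y' in I | key y' < key z] | e z w]).
  exact: linkI.
apply/setP=> w; rewrite /link DE !inE.
have [->|nwz] := eqVneq w z; first by rewrite ltnn (negPf zW) /= andbF.
case: (w \in W) => //=; case Iw: (w \in I) => //=.
rewrite [key w < _]ltn_neqAle (max_z _ Iw) andbT.
by have [eqk|//] := eqVneq; rewrite (negPf (keyI _ _ Iw Iz nwz eqk)).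
Qed.


(** * From vertex decompositions to shellings *)

(** The exchange form of a shelling, with [acc] the facets already listed: the intersection of [s]
    with an earlier [t] lies in the codimension-one face [s :\ x], itself inside an earlier
    facet. *)
Fixpoint shell_from (acc l : seq {set T}) : Prop :=
  if l is s :: l' then
    (forall t, t \in acc ->
       exists x, [/\ x \in s, x \notin t & exists2 u, u \in acc & s :\ x \subset u])
    /\ shell_from (rcons acc s) l'
  else True.

Lemma shell_from_cat acc l1 l2 :
  shell_from acc (l1 ++ l2) <-> shell_from acc l1 /\ shell_from (acc ++ l1) l2.
Proof.
elim: l1 acc => [|s l1 IH] acc /=; first by rewrite cats0; tauto.
by rewrite IH cat_rcons; tauto.
Qed.

Lemma shell_from_nth acc l i : shell_from acc l -> i < size l ->
  forall t, t \in acc ++ take i l ->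
    exists x, [/\ x \in nth set0 l i, x \notin t
      & exists2 u, u \in acc ++ take i l & nth set0 l i :\ x \subset u].
Proof.
elim: l acc i => [|s l IH] acc [|i] //= [ss sl] lti; first by rewrite cats0.
by rewrite -cat_rcons; apply: IH.
Qed.

(** Here [ld] stands for the facets of the deletion of [v]. Against these, [v] is the vertex to
    remove; against earlier cones, the vertex comes from the shelling of the link. *)
Lemma shell_from_cone v (ld acc l : seq {set T}) :
    (forall u, u \in ld -> v \notin u) ->
    (forall c, c \in acc ++ l -> v \notin c /\ exists2 u, u \in ld & c \subset u) ->
  shell_from acc l ->
  shell_from (ld ++ map (setU [set v]) acc) (map (setU [set v]) l).
Proof.
move=> ldv; elim: l acc => [|c l IH] acc //= cv [sc sl]; split; last first.
  by rewrite rcons_cat -map_rcons; apply: IH => //; rewrite cat_rcons.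
have [vc [u ldu cu]] : v \notin c /\ exists2 u, u \in ld & c \subset u.
  by apply: cv; rewrite mem_cat mem_head orbT.
move=> t; rewrite mem_cat => /orP[ldt|/mapP[c0 acc0 ->]].
  exists v; split; [exact: setU11 | exact: ldv |].
  by exists u; rewrite ?mem_cat ?ldu // setU1K.
have [x [cx c0x [w accw cw]]] := sc _ acc0; exists x.
have nxv : x != v by apply: contraNneq vc => <-.
split; first by rewrite !inE cx orbT.
  by rewrite !inE (negPf nxv).
exists (v |: w); first by rewrite mem_cat map_f ?orbT.
apply/subsetP=> y; rewrite !inE => /andP[nyx /predU1P[->|cy]]; first by rewrite eqxx.
by rewrite (subsetP cw) ?orbT // !inE nyx.
Qed.

Definition is_face P k c := [/\ c \subset P, clique c & #|c| = k].

(** A clique through [v] is extended inside the link of [v], any other one inside the deletion. *)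
Lemma skel_dec_pure P k c :
  skel_dec P k -> c \subset P -> clique c -> #|c| <= k ->
  exists2 f, is_face P k f & c \subset f.
Proof.
move=> SP; elim: SP c => {P k}.
- move=> P c sP clc; rewrite leqn0 cards_eq0 => /eqP->; exists set0 => //.
  by split; rewrite ?sub0set ?cards0 // => x; rewrite inE.
- by move=> P clP c sP _ _; exists P.
move=> P v k Pv _ IH1 _ IH2 c sP clc lec.
have [vc|vc] := boolP (v \in c); last first.
  have [|//|f [sf clf cf] cf'] := IH1 c _ clc.
    by rewrite subsetD1 sP.
  by exists f => //; split=> //; apply: subset_trans sf (subD1set _ _).
have [|||f [sf clf cf] cf'] := IH2 (c :\ v).
- apply/subsetP=> x /setD1P[nxv cx]; rewrite !inE nxv (subsetP sP) //=; exact: clc.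
- by move=> x y /setD1P[_ cx] /setD1P[_ cy]; apply: clc.
- by rewrite (cardsD1 v) vc in lec.
have ev x : x \in f -> [/\ x != v, x \in P & e v x].
  by move=> /(subsetP sf); rewrite !inE => /andP[/andP[]].
exists (v |: f); last first.
  by rewrite -(setD1K vc) setUS.
split.
- by rewrite subUset sub1set Pv; apply/subsetP=> x /ev[].
- move=> x y /setU1P[->|fx] /setU1P[->|fy]; first exact: e_refl.
  + by have [] := ev y fy.
  + by rewrite e_sym; have [] := ev x fx.
  + exact: clf.
rewrite cardsU1 cf; case vf: (v \in f) => //.
by have [] := ev v vf; rewrite eqxx.
Qed.

Lemma skel_dec_shell P k : skel_dec P k ->
  exists l, [/\ uniq l, forall c, c \in l <-> is_face P k c & shell_from [::] l].
Proof.
elim=> {P k}.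
- move=> P; exists [:: set0]; split=> //= c; rewrite inE; split.
    by move/eqP->; split; rewrite ?sub0set ?cards0 // => x; rewrite inE.
  by case=> _ _ /eqP; rewrite cards_eq0.
- move=> P clP; exists [:: P]; split=> //= c; rewrite inE; split; first by move/eqP->.
  by case=> sP _ cE; rewrite eqEcard sP cE /=.
move=> P v k Pv S1 [l1 [u1 m1 s1]] S2 [l2 [u2 m2 s2]].
have l1v u : u \in l1 -> v \notin u.
  by case/m1=> + _ _; rewrite subsetD1 => /andP[].
have l2v u : u \in l2 -> v \notin u.
  by case/m2=> /subset_trans/(_ (link_sub _ _)) + _ _; rewrite subsetD1 => /andP[].
exists (l1 ++ map (setU [set v]) l2); split.
- rewrite cat_uniq u1 /=; apply/andP; split.
    apply/hasPn=> _ /mapP[c _ ->]; apply/negP=> /l1v; rewrite setU11 //.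
  rewrite map_inj_in_uniq // => c d /l2v vc /l2v vd /(congr1 (fun f => f :\ v)).
  by rewrite !setU1K.
- move=> c; rewrite mem_cat; split.
    case/orP=> [/m1[sc clc cc]|/mapP[d l2d ->]].
      by split=> //; apply: subset_trans sc (subD1set _ _).
    have /m2[sd cld cd] := l2d.
    have ev x : x \in d -> x \in P /\ e v x.
      by move=> /(subsetP sd); rewrite !inE => /andP[/andP[]].
    split; last by rewrite cardsU1 l2v // cd.
      by rewrite subUset sub1set Pv; apply/subsetP=> x /ev[].
    move=> x y /setU1P[->|fx] /setU1P[->|fy]; first exact: e_refl.
    + by have [] := ev y fy.
    + by rewrite e_sym; have [] := ev x fx.
    + exact: cld.
  case=> sc clc cc; have [vc|vc] := boolP (v \in c); last first.
    by apply/orP; left; apply/m1; split; rewrite ?subsetD1 ?sc.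
  apply/orP; right; apply/mapP; exists (c :\ v); last by rewrite setD1K.
  apply/m2; split.
  + apply/subsetP=> x /setD1P[nxv cx]; rewrite !inE nxv (subsetP sc) //=; exact: clc.
  + by move=> x y /setD1P[_ cx] /setD1P[_ cy]; apply: clc.
  + by move: cc; rewrite (cardsD1 v) vc => -[].
apply/shell_from_cat; split=> //=.
rewrite -[l1 in shell_from l1]cats0 -[X in l1 ++ X]/(map (setU [set v]) [::]).
apply: shell_from_cone => //= c l2c; split; first exact: l2v.
have /m2[sc clc cc] := l2c.
have [|f m1f cf] := skel_dec_pure S1 (subset_trans sc (link_sub _ _)) clc.
  by rewrite cc.
by exists f => //; apply/m1.
Qed.

End CliqueComplexes.

(** * Purity and shellability for skeleta of order complexes *)

Definition comparable_by (T : finType) (le : rel T) : rel T :=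
  fun x y => le x y || le y x.

Section SkeletonShelling.

Variables (T : finType) (le : rel T) (P : {set T}) (k : nat).
Hypothesis le_refl : reflexive le.

Local Notation e := (comparable_by le).
Local Notation K := (skeleton (k%:Z - 1)%R (order_complex le P)).

Lemma mem_skeleton c : c \in K <-> [/\ c \subset P, clique e c & #|c| <= k].
Proof.
rewrite !inE /sdim; split.
  case/andP=> /andP[sP /forall_inP clc] lec; split=> //; last by lia.
  by move=> x y cx cy; apply: (forall_inP (clc x cx)).
case=> sP clc lec; rewrite sP /=; apply/andP; split; last by lia.
by apply/forall_inP=> x cx; apply/forall_inP=> y cy; apply: clc.
Qed.

Hypothesis SP : skel_dec e P k.

Let e_refl : reflexive e. Proof. by move=> x; rewrite /e le_refl. Qed.
Let e_sym : symmetric e. Proof. by move=> x y; rewrite /e orbC. Qed.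

Lemma facet_skeleton c : c \in facets K <-> is_face e P k c.
Proof.
rewrite inE; split.
  case/maxsetP=> /mem_skeleton[sc clc lec] maxc.
  have [f [sf clf cf] scf] := skel_dec_pure e_refl e_sym SP sc clc lec.
  have <- : f = c by apply: maxc => //; apply/mem_skeleton; rewrite cf.
  by [].
case=> sc clc cc; apply/maxsetP; split; first by apply/mem_skeleton; rewrite cc.
move=> f /mem_skeleton[_ _ lef] scf; apply/esym/eqP.
by rewrite eqEcard scf cc.
Qed.

Lemma skel_dec_pure_of_dim : pure_of_dim (k%:Z - 1)%R K.
Proof.
split; last by move=> s /facet_skeleton[_ _ cs]; rewrite /sdim cs.
apply/set0Pn; exists set0; apply/mem_skeleton.
by split; rewrite ?sub0set ?cards0 // => x; rewrite inE.
Qed.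

Lemma skel_dec_shellable : shellable K.
Proof.
have [l [ul ml sl]] := skel_dec_shell e_refl e_sym SP.
exists l; split=> //.
  by move=> c; apply/idP/idP => [/ml/facet_skeleton|/facet_skeleton/ml].
move=> i /andP[i_gt0 lti] /=; set s := nth set0 l i.
have step := shell_from_nth sl lti; rewrite /= -/s in step.
split.
  apply/set0Pn; exists set0; rewrite !inE sub0set /=; apply/hasP.
  by exists (nth set0 (take i l) 0); rewrite ?sub0set // mem_nth // size_take lti.
move=> t; rewrite inE => /maxsetP[]; rewrite !inE => /andP[ts /hasP[u lu tu]] maxt.
have [x [sx ux [w lw sw]]] := step u lu.
have <- : s :\ x = t.
  apply: maxt; first by rewrite !inE subD1set /=; apply/hasP; exists w.
  by rewrite subsetD1 ts /=; apply: contra ux; apply: (subsetP tu).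
by rewrite /sdim [in RHS](cardsD1 x) sx; lia.
Qed.

End SkeletonShelling.

Local Open Scope group_scope.

(** * Intervals of the subgroup lattice and modular elements *)

Section SubgroupIntervals.

Variables (gT : finGroupType) (G : {group gT}).
Implicit Types (A B C H X Y Z : {group gT}).

Local Notation comp := (comparable_by (@subgroup_le gT)).

Definition open_itv A B : {set {group gT}} :=
  [set X : {group gT} | (A \proper X) && (X \proper B)].

(** These subgroups form the part below [B] of the link of [B] when [B] is shed from a larger
    interval. *)
Definition non_supplements A B H : {set {group gT}} :=
  [set X in open_itv A B | ~~ (B \subset X <*> H)].

Lemma ltn_lex_key (n a b c d : nat) :
  a < c -> (a * n.+1 + (n - b) < c * n.+1 + (n - d))%N.
Proof. by move=> lt_ac; nia. Qed.

Lemma comp_refl : reflexive comp.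
Proof. by move=> X; rewrite /comparable_by /subgroup_le subxx. Qed.

Lemma comp_sym : symmetric comp.
Proof. by move=> X Y; rewrite /comparable_by orbC. Qed.

Lemma joined_above (P Q : {set {group gT}}) Z :
    (forall X, X \in P -> X \proper Z) -> (forall Y, Y \in Q -> Z \subset Y) ->
  joined comp P Q.
Proof.
move=> PZ QZ X Y /PZ XZ /QZ ZY; have XY := proper_sub_trans XZ ZY.
rewrite /comparable_by /subgroup_le (proper_sub XY) andbT.
by apply: contraTneq XY => ->; rewrite properxx.
Qed.

Lemma skel_dec_cone_itv A B k :
  skel_dec comp (open_itv A B) k -> skel_dec comp (A |: open_itv A B) k.+1.
Proof.
move=> S; apply: (skel_dec_cone comp_refl comp_sym _ S); apply: (joined_sym comp_sym).
move=> X Y; rewrite !inE => /andP[AX _] /eqP->.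
rewrite /comparable_by /subgroup_le (proper_sub AX) orbT andbT.
by apply: contraTneq AX => ->; rewrite properxx.
Qed.

(** Dedekind's law turns [X <*> H :&: B] into the product of [X] and [H :&: B], both contained in
    [X]. *)
Lemma modular_sub H B X :
  H <| G -> X \subset G -> H :&: B \subset X -> X \subset B ->
  X <*> H :&: B \subset X.
Proof.
move=> nHG sXG sHBX sXB; rewrite norm_joinEl ?(subset_trans sXG) ?normal_norm //.
by rewrite -group_modl // mul_subG.
Qed.

(* The element M is modular in the interval.  The vertices Z incomparable to M are
   shed by decreasing closure C = Z H :&: B and, for equal closures, by increasing
   Z.  When Z is shed, its link is the join of the non-supplements of H below Z
   with the interval from Z to C and, if C < B, the cone with apex C over the
   interval from C to B.  What remains at the end is a cone with apex M. *)
Lemma open_itv_modular_split A B H (b : bool) (g : {group gT} -> {group gT} -> nat) :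
    H <| G -> B \subset G ->
    let M := (A <*> H :&: B)%G in
    A \proper M -> M \proper B ->
    (forall X Y, X \proper Y -> 0 < g X Y) ->
    (forall X Y, X \subset Y -> Y \subset B -> g X B <= g X Y + g Y B) ->
    (forall X Y, X \proper Y -> A \subset X -> Y \subset B ->
       (A != X) || (Y != B) -> skel_dec comp (open_itv X Y) (g X Y).-1) ->
    (forall Z, A \proper Z -> Z \proper B -> ~~ (Z \subset A <*> H) ->
       skel_dec comp (non_supplements A Z H) (g A Z).-1) ->
  skel_dec comp [set X in open_itv A B | b || ~~ (B \subset X <*> H)] (g A B).-1.
Proof.
move=> nHG sBG M ltAM ltMB g_gt0 g_add IHitv IHns.
have csym := comp_sym.
have sMB := proper_sub ltMB; have sAM := proper_sub ltAM.
have sAB := subset_trans sAM sMB; have sAG := subset_trans sAB sBG.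
have sMAH : M \subset A <*> H by apply: subsetIl.
have sHBM : H :&: B \subset M by apply: setSI; apply: joing_subr.
(* [W] collects what is comparable to [M], [I] the rest. The flag [b] treats the whole interval and
   the non-supplements at once. *)
pose W := open_itv A M :|: (M |: open_itv M B).
pose I := [set X in open_itv A B |
  [&& ~~ (X \subset M), ~~ (M \subset X) & b || ~~ (B \subset X <*> H)]].
have -> : [set X in open_itv A B | b || ~~ (B \subset X <*> H)] = W :|: I.
  apply/setP=> X; rewrite !inE.
  apply/andP/idP=> [[/andP[AX XB] bX]|].
    rewrite AX XB bX !andbT; have [->|neqXM] := eqVneq X M; first by rewrite orbT.
    rewrite [M \proper X]properEneq [X \proper M]properEneq [M :==: X]eq_sym.
    rewrite (neqXM : X :!=: M) /=.
    by case: (X \subset M); case: (M \subset X).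
  have sMX X' : M \subset X' -> X' \proper B -> ~~ (B \subset X' <*> H).
    move=> MX' ltX'B; apply/negP=> BX'.
    have sX'G := subset_trans (proper_sub ltX'B) sBG.
    have := modular_sub nHG sX'G (subset_trans sHBM MX') (proper_sub ltX'B).
    by rewrite (setIidPr BX') => /(proper_sub_trans ltX'B); rewrite properxx.
  case/orP; last by case/andP=> -> /and3P[_ _ ->].
  case/or3P.
  - case/andP=> AX XM; rewrite AX (proper_trans XM ltMB); split=> //.
    apply/orP; right; apply: contraL ltMB => BX; rewrite properE sMB /= negbK.
    rewrite subsetI subxx andbT (subset_trans BX) // join_subG joing_subr andbT.
    exact: subset_trans (proper_sub XM) sMAH.
  - by move/eqP=> XM; rewrite XM ltAM ltMB sMX ?XM ?orbT.
  - by case/andP=> MX XB; rewrite (proper_trans ltAM MX) XB sMX ?orbT ?proper_sub.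
case Eg: (g A B).-1 => [|k]; first exact: SkelDec0.
pose cl X := (X <*> H :&: B)%G.
have sXcl X : X \subset B -> X \subset cl X.
  by move=> XB; rewrite subsetI joing_subl XB.
(* The order of the closure is the leading digit; for equal closures the smaller subgroup gets the
   larger key and is shed earlier. *)
pose key X := (#|cl X| * #|G|.+1 + (#|G| - #|X|))%N.
have leG X : X \subset B -> #|X| <= #|G|.
  by move=> XB; apply: subset_leq_card; apply: subset_trans sBG.
have key1 X Y : X \subset B -> Y \subset B -> cl X \proper cl Y -> key X < key Y.
  move=> /leG leX /leG leY /proper_card; rewrite /key.
  exact: ltn_lex_key.
have key2 X Y : X \subset B -> Y \subset B -> cl X :=: cl Y -> Y \proper X ->
    key X < key Y.
  move=> /leG leX /leG leY eqc /proper_card ltYX; rewrite /key eqc ltn_add2l.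
  by rewrite ltn_sub2l // (leq_trans ltYX).
have clS X Y : X \subset Y -> cl X \subset cl Y by move=> XY; apply/setSI/genS/setSU.
have clM X : M \subset X -> X \subset B -> cl X \subset X.
  move=> MX XB; apply: (modular_sub nHG) => //; first exact: subset_trans sBG.
  exact: subset_trans sHBM MX.
have WP X : X \in W -> [/\ A \proper X, X \proper B & X \subset M \/ M \subset X].
  rewrite !inE => /or3P[/andP[AX XM]|/eqP->|/andP[MX XB]]; split=> //.
  - exact: proper_trans XM ltMB.
  - by left; apply: proper_sub.
  - by left.
  - exact: proper_trans MX.
  - by right; apply: proper_sub.
apply: (@skel_dec_extend _ _ _ _ key).
- rewrite disjoint_subset; apply/subsetP=> X; rewrite !inE.
  case/or3P=> [/andP[_ /proper_sub->]|/eqP->|/andP[/proper_sub->]].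
  + by rewrite !(andbF, andFb).
  + by rewrite subxx !(andbF, andFb).
  + by rewrite !(andbF, andFb).
- move=> X Y; rewrite !inE => /andP[/andP[_ /proper_sub XB] _] /andP[/andP[_ /proper_sub YB] _].
  move=> nXY eqk; apply/negP.
  wlog XY : X Y XB YB nXY eqk / X \subset Y.
    move=> IH /orP[] /= c; last by apply: (IH X Y) => //; apply/orP; right.
    by apply: (IH Y X) => //; rewrite 1?eq_sym //; apply/orP; right.
  move=> _; have ltXY : X \proper Y by rewrite properEneq XY andbT.
  have [eqc|nec] := eqVneq (cl X : {set gT}) (cl Y).
    by have:= key2 _ _ YB XB (esym eqc) ltXY; rewrite eqk ltnn.
  have:= key1 _ _ XB YB; rewrite properEneq nec clS // => /(_ isT).
  by rewrite eqk ltnn.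
- move=> Z; rewrite inE inE => /andP[/andP[ltAZ ltZB] /and3P[nZM nMZ bZ]].
  have sZB := proper_sub ltZB; have sAZ := proper_sub ltAZ.
  have nZAH : ~~ (Z \subset A <*> H).
    by apply: contra nZM => sZ; rewrite subsetI sZ.
  pose C := cl Z.
  have sMC : M \subset C by apply: clS.
  have sCB : C \subset B by apply: subsetIr.
  have ltZC : Z \proper C.
    by rewrite properE sXcl //=; apply: contra nMZ; apply: subset_trans.
  pose U2 := if C \proper B then C |: open_itv C B else set0.
  pose U := open_itv Z C :|: U2.
  (* A neighbour above [M] equals its closure, so it contains [C]. A remaining one above [Z] has the
     same closure as [Z]. One below [Z] that supplements [H] in [Z] would have this closure too,
     hence a larger key. *)
  have linkE : [set X in W :|: [set Y in I | key Y < key Z] | comp Z X]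
     = non_supplements A Z H :|: U.
    apply/setP=> X; rewrite [LHS]inE [X \in W :|: _]inE; apply/andP/idP.
    + case=> /orP[|].
      * case/WP=> AX XB [XM|MX] cZX; rewrite inE; apply/orP.
          have nZX : ~~ (Z \subset X) by apply: contra nZM => /subset_trans->.
          have XZ : X \subset Z by case/orP: cZX => //; rewrite /subgroup_le (negPf nZX).
          left; rewrite !inE AX properE XZ nZX /=; apply: contra nZAH => ZX.
          apply: subset_trans ZX _; rewrite join_subG joing_subr andbT.
          exact: subset_trans XM sMAH.
        have nXZ : ~~ (X \subset Z) by apply: contra nMZ; apply: subset_trans.
        have ZX : Z \subset X by case/orP: cZX => //; rewrite /subgroup_le (negPf nXZ).
        have CX : C \subset X by apply: subset_trans (clS _ _ ZX) (clM _ MX (proper_sub XB)).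
        right; rewrite inE; apply/orP; right; rewrite /U2 (sub_proper_trans CX XB).
        by rewrite !inE XB andbT [C \proper X]properEneq CX andbT -val_eqE eq_sym orbN.
      rewrite inE => /andP[]; rewrite !inE => /andP[/andP[AX XB] /and3P[nXM nMX bX]] ltk.
      have sXB := proper_sub XB.
      have neqXZ : X :!=: Z.
        by apply: contraTneq ltk => eqXZ; rewrite -leqNgt (_ : X = Z) //; apply: val_inj.
      rewrite /comparable_by /subgroup_le; case/orP=> [ZX|XZ].
      * have eqc : cl Z :=: cl X.
          apply/eqP/negPn/negP=> nec; have:= key1 _ _ sZB sXB.
          by rewrite properEneq nec clS // => /(_ isT); rewrite ltnNge ltnW.
        have XC : X \proper C.
          have sXC : X \subset C by have:= sXcl _ sXB; rewrite -eqc.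
          by rewrite properEneq sXC andbT; apply: contraNneq nMX => ->.
        apply/orP; right; apply/orP; left.
        by rewrite [Z \proper X]properEneq eq_sym neqXZ ZX.
      apply/orP; left; rewrite AX properEneq neqXZ XZ /=; apply/negP=> ZX.
      have eqc : cl Z :=: cl X.
        apply/eqP; rewrite eqEsubset (clS _ _ XZ) andbT setSI //.
        by rewrite join_subG ZX joing_subr.
      by have:= key2 _ _ sZB sXB eqc; rewrite properEneq neqXZ XZ ltnNge ltnW // => /(_ isT).
    case/setUP=> [|/setUP[|]].
    + rewrite !inE => /andP[/andP[AX XZ] nZX]; have sXZ := proper_sub XZ.
      rewrite /comparable_by /subgroup_le sXZ orbT; split=> //.
      have XB := proper_trans XZ ltZB; have sXB := proper_sub XB.
      have nMX : ~~ (M \subset X) by apply: contra nMZ => /subset_trans->.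
      have [XM|nXM] := boolP (X \subset M).
        by apply/orP; left; rewrite AX properE XM nMX.
      rewrite AX XB nMX /=; apply/orP; right; apply/andP; split.
        by apply/orP; right; apply: contra nZX; apply: subset_trans.
      apply: key1 => //; rewrite properE clS //=; apply: contra nZX => ZX.
      by apply: subset_trans (subset_trans (sXcl _ sZB) ZX) (subsetIl _ _).
    + rewrite !inE => /andP[ZX XC]; have sZX := proper_sub ZX; have sXC := proper_sub XC.
      rewrite /comparable_by /subgroup_le sZX; split=> //; apply/orP; right.
      have XB := proper_sub_trans XC sCB; have sXB := proper_sub XB.
      have nMX : ~~ (M \subset X).
        apply/negP=> MX; have:= subset_trans (clS _ _ sZX) (clM _ MX sXB).
        by move/(proper_sub_trans XC); rewrite properxx.
      have sXHZ : X <*> H \subset Z <*> H.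
        rewrite join_subG joing_subr andbT; exact: subset_trans sXC (subsetIl _ _).
      rewrite (proper_trans ltAZ ZX) XB nMX /=; apply/andP; split.
        rewrite (contra (subset_trans sZX) nZM) /=.
        by case/orP: bZ => [->//|nBZ]; rewrite (contra _ nBZ) ?orbT // => /subset_trans->.
      apply: key2 => //; apply/eqP; rewrite eqEsubset (clS _ _ sZX) andbT; exact: setSI.
    rewrite /U2; case: ifP => [ltCB|_]; last by rewrite in_set0.
    move=> XU; have [CX XB] : C \subset X /\ X \proper B.
      by move: XU; rewrite !inE => /predU1P[->//|/andP[/proper_sub]].
    have MX := subset_trans sMC CX; split; last first.
      by rewrite /comparable_by /subgroup_le (subset_trans (proper_sub ltZC) CX).
    apply/orP; left; have [->|neqXM] := eqVneq X M; first by rewrite !inE eqxx orbT.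
    by rewrite !inE XB andbT [M \proper X]properEneq [M :==: X]eq_sym (neqXM : X :!=: M) MX !orbT.
  rewrite linkE.
  have SU2 : skel_dec comp U2 (if C \proper B then g C B else 0).
    rewrite /U2; case: ifP => [ltCB|_]; last exact: SkelDec0.
    rewrite -(prednK (g_gt0 _ _ ltCB)); apply: skel_dec_cone_itv.
    apply: IHitv => //; first exact: subset_trans sAZ (proper_sub ltZC).
    by apply/orP; left; apply: contraTneq (proper_sub_trans ltAM sMC) => <-; rewrite properxx.
  have SU : skel_dec comp U ((g Z C).-1 + (if C \proper B then g C B else 0)).
    apply: skel_dec_join SU2 => //.
      apply: (@joined_above _ _ C) => X; first by rewrite inE => /andP[].
      rewrite /U2; case: ifP => _; rewrite !inE //.
      by case/predU1P=> [->//|/andP[/proper_sub]].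
    apply: IHitv => //.
    by apply/orP; left; apply: contraTneq ltAZ => <-; rewrite properxx.
  have SL := IHns _ ltAZ ltZB nZAH.
  apply: (skel_dec_leq _ (skel_dec_join csym _ SL SU)); last first.
    apply: (@joined_above _ _ Z) => X; first by rewrite !inE => /andP[/andP[]].
    rewrite inE => /orP[|]; first by rewrite inE => /andP[/proper_sub].
    rewrite /U2; case: ifP => _; rewrite !inE //.
    have sZC := proper_sub ltZC.
    by case/predU1P=> [->//|/andP[/proper_sub/(subset_trans sZC)]].
  (* Subadditivity bounds [g A B] by [g A Z + g Z C + g C B]. The two predecessors lose 2: one for
     the predecessor of [g A B], one for passing to a link. *)
  have g1 := g_add _ _ sAZ sZB; have g2 := g_add _ _ (proper_sub ltZC) sCB.
  have g3 := g_gt0 _ _ ltAZ; have g4 := g_gt0 _ _ ltZC.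
  case: ifP => [ltCB|]; first by move: Eg g1 g2 g3 g4; clear; lia.
  rewrite properEneq sCB andbT => /negbFE/eqP eqCB.
  have eqCB' : C = B by apply: val_inj.
  by rewrite eqCB' in g2 g4 *; move: Eg g1 g3 g4; clear; lia.
have SM : skel_dec comp (M |: open_itv M B) (g M B).-1.+1.
  apply: skel_dec_cone_itv; apply: IHitv => //.
  by apply/orP; left; apply: contraTneq ltAM => <-; rewrite properxx.
have SA : skel_dec comp (open_itv A M) (g A M).-1.
  apply: IHitv => //.
  by apply/orP; right; apply: contraTneq ltMB => ->; rewrite properxx.
apply: (skel_dec_leq _ (skel_dec_join csym _ SA SM)); last first.
  apply: (@joined_above _ _ M) => X; first by rewrite inE => /andP[].
  by rewrite !inE => /predU1P[->//|/andP[/proper_sub]].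
by move: Eg (g_add _ _ sAM sMB) (g_gt0 _ _ ltMB) (g_gt0 _ _ ltAM); clear; lia.
Qed.

End SubgroupIntervals.

(** * Saturated chains of subgroups *)

Section SaturatedChains.

Variable gT : finGroupType.
Implicit Types A B C X : {group gT}.

Definition maximal_in : rel {group gT} := fun X Y => maximal X Y.

Definition has_saturated_chain A B n :=
  [exists t : n.-tuple {group gT}, path maximal_in A t && (last A t == B)].

Lemma has_saturated_chainP A B n :
  reflect (exists t, [/\ path maximal_in A t, last A t = B & size t = n])
          (has_saturated_chain A B n).
Proof.
apply: (iffP existsP) => [[t /andP[pt /eqP lt]]|[t [pt lt /eqP st]]].
  by exists t; rewrite size_tuple.
by exists (Tuple st); rewrite /= pt lt eqxx.
Qed.

Lemma has_saturated_chain_cat A B C m n :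
  has_saturated_chain A C m -> has_saturated_chain C B n ->
  has_saturated_chain A B (m + n).
Proof.
case/has_saturated_chainP=> s [ps ls ss] /has_saturated_chainP[t [pt lt st]].
apply/has_saturated_chainP; exists (s ++ t).
by rewrite cat_path ps ls pt last_cat ls lt size_cat ss st.
Qed.

Lemma has_saturated_chain0 A B : has_saturated_chain A B 0 -> A = B.
Proof. by case/has_saturated_chainP=> -[|X t] []. Qed.

Lemma has_saturated_chain1 A B : maximal A B -> has_saturated_chain A B 1.
Proof. by move=> mAB; apply/has_saturated_chainP; exists [:: B]; rewrite /= andbT. Qed.

End SaturatedChains.

(** * Jumps along a normal series and the depth of an interval *)

Section NormalChain.

Variables (gT : finGroupType) (G : {group gT}) (N : nat -> {group gT}) (r : nat).
Hypothesis nNG : forall i, N i <| G.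
Hypothesis NS : forall i, N i \subset N i.+1.
Implicit Types A B C X : {group gT}.

Lemma normal_chain_mono i j : i <= j -> N i \subset N j.
Proof.
move/subnKC<-; elim: (j - i)%N => [|k IHk]; first by rewrite addn0.
by rewrite addnS; apply: subset_trans IHk (NS _).
Qed.

(* The chain of the subgroups [A N_i :&: B] climbs from [A] to [B]; [jump A B i]
   says that its [i]-th step is strict. *)
Definition jump A B i := ~~ (A <*> N i.+1 :&: B \subset A <*> N i).

Definition njump A B := (\sum_(i < r) jump A B i)%N.

Lemma mem_join_normal A i x : A \subset G -> x \in A <*> N i ->
  exists a n, [/\ a \in A, n \in N i & x = a * n].
Proof.
move=> sAG; rewrite norm_joinEl ?(subset_trans sAG) ?normal_norm //.
by case/mulsgP=> a n Aa Nn ->; exists a, n.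
Qed.

(** If neither part jumps, an element of [A <*> N i.+1 :&: B] is [c * n] with [c] in [C] and [n] in
    [N i]; then [c] lies in [A <*> N i.+1], hence in [A <*> N i]. *)
Lemma jump_trans A B C i : A \subset C -> C \subset B -> B \subset G ->
  jump A B i -> jump A C i || jump C B i.
Proof.
move=> sAC sCB sBG; apply: contraLR; rewrite negb_or !negbK => /andP[jAC jCB].
apply/subsetP=> x /setIP[xAN Bx].
have sCG := subset_trans sCB sBG; have sAG := subset_trans sAC sCG.
have xC : x \in C <*> N i.
  by apply: (subsetP jCB); rewrite inE Bx (subsetP (genS (setSU _ sAC))).
have [c [n [Cc Nn Ex]]] := mem_join_normal sCG xC.
have cA : c \in A <*> N i.
  apply: (subsetP jAC); rewrite inE Cc andbT.
  have -> : c = x * n^-1 by rewrite Ex mulgK.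
  by rewrite groupM // groupV (subsetP (joing_subr _ _)) // (subsetP (NS _)).
by rewrite Ex groupM // (subsetP (joing_subr _ _)).
Qed.

Lemma njump_add A B C : A \subset C -> C \subset B -> B \subset G ->
  njump A B <= njump A C + njump C B.
Proof.
move=> sAC sCB sBG; rewrite -big_split /=; apply: leq_sum => i _.
have := jump_trans (i := i) sAC sCB sBG.
by case: jump => // /(_ isT); case: jump => //; case: jump.
Qed.

(** The groups [A <*> N i :&: B] increase with [i] and can only be [A] or [B], so they grow at most
    once. *)
Lemma njump_le1 A B : A \subset B ->
  (forall i, i <= r -> A <*> N i :&: B \subset A \/ B \subset A <*> N i) -> njump A B <= 1.
Proof.
move=> sAB itv; rewrite /njump.
have jump_uniq i j : i < j -> j < r -> jump A B i -> jump A B j -> False.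
  move=> ltij ltjr; have [|sA|sB] := itv i.+1; first exact: leq_trans (ltnW ltjr).
    by rewrite /jump (subset_trans sA) ?joing_subl.
  move=> _; rewrite /jump (subset_trans (subsetIr _ _)) // (subset_trans sB) //.
  by rewrite genS // setUS // normal_chain_mono.
have [/existsP[j Jj]|noJ] := boolP [exists j : 'I_r, jump A B j]; last first.
  rewrite big1 // => i _; move: noJ; rewrite negb_exists => /forallP/(_ i).
  by move/negPf->.
rewrite (bigD1 j) //= Jj big1 // => i neij.
case Ji: (jump A B i) => //; have:= neij; rewrite -val_eqE /= neq_ltn.
by case/orP=> lt; [case: (jump_uniq i j) | case: (jump_uniq j i)].
Qed.

Lemma njump_maximal A B : maximal A B -> njump A B <= 1.
Proof.
case/maxgroupP=> ltAB maxA; apply: njump_le1 (proper_sub ltAB) _ => i _.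
have [sB|nsB] := boolP (B \subset A <*> N i); [by right | left].
have := maxA (A <*> N i :&: B)%G; rewrite /= => -> //.
  rewrite properE subsetIr /=; apply: contra nsB => /subset_trans; apply.
  exact: subsetIl.
by rewrite subsetI joing_subl proper_sub.
Qed.

(* One more than the connectivity bound proved below for the open interval
   between [A] and [B]: every saturated chain has at least [njump A B] steps, and
   one unit is gained when no chain attains this minimum. *)
Definition itv_depth A B :=
  (njump A B + ~~ has_saturated_chain A B (njump A B))%N.

Lemma itv_depth_gt0 A B : A \proper B -> 0 < itv_depth A B.
Proof.
move=> ltAB; rewrite /itv_depth; case: njump => // .
case: (boolP (has_saturated_chain _ _ _)) => // /has_saturated_chain0 eqAB.
by rewrite eqAB properxx in ltAB.
Qed.

(** If the jump counts are strictly subadditive, the slack absorbs the extra unit; if they add up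
    exactly, chains attaining the bound on both parts concatenate to one attaining it from [A] to
    [B]. *)
Lemma itv_depth_add A C B : A \subset C -> C \subset B -> B \subset G ->
  itv_depth A B <= itv_depth A C + itv_depth C B.
Proof.
move=> sAC sCB sBG; have := njump_add sAC sCB sBG; rewrite /itv_depth.
rewrite leq_eqVlt => /orP[/eqP->|]; last first.
  by case: (has_saturated_chain A B _); case: (has_saturated_chain A C _);
     case: (has_saturated_chain C B _); move=> /=; lia.
have := @has_saturated_chain_cat _ A B C (njump A C) (njump C B).
case: (has_saturated_chain A C _); case: (has_saturated_chain C B _);
  case: (has_saturated_chain A B _) => //=; lia.
Qed.

(** Both claims go by one induction on [#|B| - #|A|], since the links in the modular splitting
    involve smaller intervals and non-supplements alike. *)
Lemma skel_dec_open_itv_and_non_supplements A B : A \proper B -> B \subset G ->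
  skel_dec (comparable_by (@subgroup_le gT)) (open_itv A B) (itv_depth A B).-1
  /\ forall i, ~~ (B \subset A <*> N i) ->
     skel_dec (comparable_by (@subgroup_le gT)) (non_supplements A B (N i))
       (itv_depth A B).-1.
Proof.
have [n] := ubnP (#|B| - #|A|)%N; elim: n A B => // n IHn A B.
rewrite ltnS => leBA ltAB sBG; have sAB := proper_sub ltAB.
have split_itv i (b : bool) : A \proper (A <*> N i :&: B)%G ->
    (A <*> N i :&: B)%G \proper B ->
  skel_dec (comparable_by (@subgroup_le gT))
    [set X in open_itv A B | b || ~~ (B \subset X <*> N i)] (itv_depth A B).-1.
  move=> ltAM ltMB; apply: (@open_itv_modular_split _ G A B (N i) b itv_depth (nNG i) sBG ltAM ltMB).
  - by move=> X Y; apply: itv_depth_gt0.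
  - move=> X Y sXY sYB; exact: itv_depth_add.
  - move=> X Y ltXY sAX sYB neq; apply: (IHn _ _ _ ltXY _).1; last exact: subset_trans sBG.
    have sXY := proper_sub ltXY; apply: leq_trans leBA.
    have cX := subset_leq_card sAX; have cY := subset_leq_card sYB.
    have cXY := proper_card ltXY.
    have : (#|A| < #|X|) || (#|Y| < #|B|).
      case/orP: neq => neq; apply/orP; [left | right]; apply: proper_card.
        by rewrite properEneq sAX andbT.
      by rewrite properEneq sYB andbT.
    by move: cX cY cXY; clear; lia.
  - move=> Z ltAZ ltZB nZ; apply: (IHn _ _ _ ltAZ _).2 => //; last first.
      exact: subset_trans (proper_sub ltZB) sBG.
    by apply: leq_trans leBA; move: (proper_card ltAZ) (proper_card ltZB); clear; lia.
have Sitv : skel_dec (comparable_by (@subgroup_le gT)) (open_itv A B) (itv_depth A B).-1.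
  have [/existsP[i /andP[lt1 lt2]]|noM] := boolP [exists i : 'I_r.+1,
      (A \proper (A <*> N i :&: B)%G) && ((A <*> N i :&: B)%G \proper B)].
    have := split_itv i true lt1 lt2.
    by rewrite (_ : [set X in _ | _] = open_itv A B) //; apply/setP=> X; rewrite inE andbT.
  (* With no [A <*> N i :&: B] strictly between, there is at most one jump and the level is at most
     1. Level 1 only asks for a non-empty interval, that is, for [A] not to be maximal in [B]. *)
  have le1 : njump A B <= 1.
    apply: njump_le1 => // i leir; move: noM; rewrite negb_exists.
    move/forallP=> /(_ (Ordinal (leir : i < r.+1))) /=; rewrite negb_and !properE.
    rewrite subsetI joing_subl sAB subsetIr !negbK /= subsetI => /orP[]; first by left.
    by case/andP; right.
  have [lej|] := leqP (itv_depth A B).-1 0.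
    by apply: (skel_dec_leq lej); apply: SkelDec0.
  rewrite /itv_depth; case Ej: (njump A B) le1 => [|[|//]] _; case: (boolP (has_saturated_chain _ _ _)) => //= noC _.
  apply: skel_dec1; first exact: comp_refl.
  apply: contra noC => /eqP itv0; apply: has_saturated_chain1; apply/maxgroupP; split=> //.
  move=> H ltHB sAH; apply/eqP; rewrite eq_sym eqEproper sAH /=; apply/negP=> ltAH.
  by move/setP/(_ H): itv0; rewrite !inE ltAH ltHB.
split=> // i nB.
(* If [A <*> N i :&: B] is [A], the modular law excludes proper supplements, and the set is the
   whole interval. *)
have [sA|nsA] := boolP (A <*> N i :&: B \subset A).
  rewrite (_ : non_supplements _ _ _ = open_itv A B) //.
  apply/setP=> X; rewrite inE; apply: andb_idr; rewrite inE => /andP[AX XB].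
  apply/negP=> BX; have sXB := proper_sub XB.
  have : X <*> N i :&: B \subset X.
    apply: (modular_sub (nNG i)) => //; first exact: subset_trans sBG.
    by rewrite (subset_trans _ (proper_sub AX)) // (subset_trans _ sA) // setSI // joing_subr.
  by rewrite (setIidPr BX) => /(proper_sub_trans XB); rewrite properxx.
apply: (split_itv i false).
  by rewrite properE subsetI joing_subl sAB.
by rewrite properE subsetIr /=; apply: contra nB => /subset_trans; apply; apply: subsetIl.
Qed.

End NormalChain.

(** * Normal subgroups with a solvable maximal complement *)

Section MaximalComplements.

Implicit Types gT : finGroupType.

(** By maximality [K <*> Q] is [K] or [K <*> N]; as [K] meets [N] trivially, intersecting with [N]
    recovers [Q]. *)
Lemma maximal_complement_invariant gT (K N Q : {group gT}) :
    K \subset 'N(N) -> K :&: N = 1 -> maximal K (K <*> N) ->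
    Q \subset N -> K \subset 'N(Q) ->
  Q :=: 1 \/ Q :=: N.
Proof.
move=> nNK tiKN /maxgroupP[_ maxK] sQN nQK.
have sKQ : K <*> Q \subset K <*> N by rewrite genS ?setUS.
have [sNKQ|nsNKQ] := boolP (K <*> N \subset K <*> Q); [right | left].
  apply/eqP; rewrite eqEsubset sQN /=.
  have sN : N \subset Q * K :&: N.
    by rewrite subsetI subxx -normC // -norm_joinEl // (subset_trans (joing_subr K N)).
  by apply: subset_trans sN _; rewrite -group_modl // tiKN mulg1.
have eqK : K <*> Q = K by apply: (maxK (K <*> Q)%G); rewrite /= ?joing_subl // properE sKQ.
apply/trivgP; rewrite -tiKN subsetI sQN andbT -eqK; exact: joing_subr.
Qed.

(* A minimal normal subgroup P of K is a p-group.  If P does not centralise N then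
   P acts on N without fixed points, so the order of N is prime to p and P
   normalises a unique Sylow q-subgroup of N; the latter is K-invariant, hence N. *)
Lemma solvable_maximal_complement gT (K N : {group gT}) :
    K \subset 'N(N) -> K :&: N = 1 -> maximal K (K <*> N) ->
  solvable K -> solvable N.
Proof.
have [n] := ubnP #|K|; elim: n gT K N => // n IHn gT K N.
rewrite ltnS => leKn nNK tiKN maxK solK.
have [->|ntN] := eqVneq (N : {set gT}) 1; first exact: solvable1.
have invar := maximal_complement_invariant nNK tiKN maxK.
have [K1|ntK] := eqVneq (K : {set gT}) 1.
  have /trivgPn[x Nx ntx] := ntN; apply: abelian_sol.
  have [||/eqP|<-] := invar <[x]>%G; last exact: cycle_abelian.
  - by rewrite cycle_subG.
  - by rewrite K1 sub1G.
  - by rewrite cycle_eq1 (negPf ntx).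
have [P [sPK nsPK ntP abP]] := solvable_norm_abelem solK (normal_refl K) ntK.
have nPK := normal_norm nsPK; have nNP := subset_trans sPK nNK.
have [||C1|CN] := invar 'C_N(P)%G.
- exact: subsetIl.
- by rewrite normsI // norms_cent.
- case/is_abelemP: abP => p p_pr abP; have pP := abelem_pgroup abP.
  have p'N : ~~ (p %| #|N|).
    have := @pgroup_fix_mod _ _ _ 'J%act p P N pP.
    rewrite astabsJ afixJ C1 cards1 => /(_ nNP) modp.
    by rewrite /dvdn modp modn_small ?prime_gt1.
  have coNP : coprime #|N| #|P|.
    by rewrite coprime_sym (pnat_coprime pP) // p'natE.
  pose q := pdiv #|N|; have q_pr : prime q by rewrite pdiv_prime // cardG_gt1.
  have [Q sylQ nQP] := sol_coprime_Sylow_exists q (pgroup_sol pP) nNP coNP.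
  have /and3P[sQN qQ _] := sylQ.
  have nQK : K \subset 'N(Q).
    apply/subsetP=> k Kk; have nNk := subsetP nNK k Kk.
    have tr := sol_coprime_Sylow_trans q (pgroup_sol pP) nNP coNP.
    have Qk_in : (Q :^ k)%G \in [set P0 in 'Syl_q(N) | P \subset 'N(P0)].
      rewrite !inE /= -{1}(normP nNk) pHallJ2 sylQ /=.
      by rewrite normJ -{1}(normP (subsetP nPK k Kk)) conjSg.
    have Q_in : Q \in [set P0 in 'Syl_q(N) | P \subset 'N(P0)] by rewrite !inE sylQ.
    have := atransP2 tr Q_in Qk_in; rewrite /= C1 => -[c /set1P-> /= Qk].
    by apply/normP; rewrite -[in RHS](conjsg1 Q) -[LHS]/(gval (Q :^ k)%G) Qk.
  have [//|//|Q1|<-] := invar Q; last exact: pgroup_sol qQ.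
  have := card_Hall sylQ; rewrite Q1 cards1 => /esym/eqP.
  by rewrite p_part_eq1 mem_primes q_pr cardG_gt0 pdiv_dvd.
(* When [P] centralises [N], it meets [N] trivially, so [N] embeds in the quotient by [P], where
   induction on the order of [K] applies. *)
have cPN : N \subset 'C(P) by rewrite -CN subsetIr.
have nPN := subset_trans cPN (cent_sub P).
have tiPN : P :&: N = 1 by apply/trivgP; rewrite -tiKN setSI.
rewrite (isog_sol (quotient_isog nPN tiPN)).
apply: (IHn _ (K / P)%G); rewrite ?quotient_sol ?quotient_norms //=.
- exact: leq_trans (ltn_quotient ntP sPK) leKn.
- by rewrite -quotientGI // tiKN quotient1.
have nsP : P <| K <*> N.
  by rewrite /normal join_subG nPK nPN (subset_trans sPK (joing_subl _ _)).
by rewrite -quotientY // quotient_maximal.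
Qed.

End MaximalComplements.

(** * Groups with a saturated chain as short as a chief series *)

Section ShortSaturatedChain.

Variables (gT : finGroupType) (G : {group gT}) (N : nat -> {group gT}) (r : nat).
Hypotheses (nNG : forall i, N i <| G) (N0 : N 0 :=: 1) (Nr : N r :=: G).
Hypothesis NS : forall i, N i \subset N i.+1.
Hypothesis Nproper : forall i, i < r -> N i \proper N i.+1.

Lemma jump_bottom i (K : {group gT}) :
  jump N 1%G K i = ~~ (N i.+1 :&: K \subset N i).
Proof. by rewrite /jump !joing1G. Qed.

Lemma njump_full : njump N r 1%G G = r.
Proof.
rewrite /njump (eq_bigr (fun=> 1%N)); first by rewrite sum1_card card_ord.
move=> i _; rewrite jump_bottom (setIidPl (normal_sub (nNG _))).
by case/andP: (Nproper (ltn_ord i)) => _ ->.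
Qed.

(** Splitting a jump repeatedly localises it at a single step of the chain. *)
Lemma jump_path (H : nat -> {group gT}) i a b :
    a <= b -> (forall j, j < b -> H j \subset H j.+1) -> H b \subset G ->
    jump N (H a) (H b) i -> exists2 j, a <= j < b & jump N (H j) (H j.+1) i.
Proof.
move=> /subnKC<-; elim: (b - a)%N => [|k IHk] HS sHG.
  by rewrite addn0 /jump (subset_trans (subsetIr _ _)) ?joing_subl.
rewrite addnS in HS sHG *; have sH j : j <= a + k -> H j \subset H (a + k).
  move/subnKC => E; rewrite -E; move: (a + k - j)%N E => d.
  elim: d j => [|d IHd] j E; first by rewrite addn0.
  have ltj : j < (a + k).+1 by lia.
  by rewrite addnS -addSn; apply: subset_trans (HS _ ltj) (IHd _ _); lia.
have sk := HS (a + k)%N (leqnn _); have sHkG := subset_trans sk sHG.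
case/(jump_trans nNG NS (sH _ (leq_addr _ _)) sk sHG)/orP => [J|J].
  have [|j /andP[aj jk] Jj] := IHk _ sHkG J.
    by move=> j ltj; apply: HS; apply: ltnW.
  by exists j => //; rewrite aj ltnW.
by exists (a + k)%N => //; rewrite leq_addr /=.
Qed.

(* Each of the r indices needs a jump, and each of the r steps of the saturated
   chain makes at most one: so every index is jumped over exactly once. *)
Lemma unique_jump i : i < r -> has_saturated_chain 1%G G r ->
  exists K L : {group gT},
    [/\ maximal K L, L \subset G, ~~ jump N 1%G K i, jump N K L i & ~~ jump N L G i].
Proof.
move=> ltir /has_saturated_chainP[t [pt lt st]].
pose H j : {group gT} := nth G (1%G :: t) j.
have maxH j : j < r -> maximal (H j) (H j.+1).
  by rewrite -st => ltj; have /(pathP G)/(_ j ltj) := pt.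
have HS j : j < r -> H j \subset H j.+1 by move/maxH/maxgroupp/proper_sub.
have Hr : H r = G by rewrite /H -st -last_nth.
have HG j : j <= r -> H j \subset G.
  move/subnKC => E; rewrite -Hr -E; move: (r - j)%N E => d.
  elim: d j => [|d IHd] j E; first by rewrite addn0.
  have ltj : j < r by lia.
  by rewrite addnS -addSn; apply: subset_trans (HS _ ltj) (IHd _ _); lia.
pose J i := (\sum_(j < r) jump N (H j) (H j.+1) i)%N.
have J_gt0 k : k < r -> 0 < J k.
  move=> ltkr; have [||j /andP[_ ltjr] Jj] := @jump_path H k 0 r (leq0n r) HS.
  - exact: HG.
  - rewrite Hr jump_bottom (setIidPl (normal_sub (nNG _))).
    by case/andP: (Nproper ltkr).
  by rewrite /J (bigD1 (Ordinal ltjr)) //= Jj.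
have sumJ : (\sum_(k < r) J k <= r)%N.
  rewrite /J exchange_big /= -[X in (_ <= X)%N]card_ord -sum1_card.
  by apply: leq_sum => j _; apply: njump_maximal => //; apply: maxH.
have J1 : J i = 1%N.
  apply/eqP; rewrite eqn_leq J_gt0 // andbT leqNgt; apply/negP=> J2.
  have: (\sum_(k < r) 1 < \sum_(k < r) J k)%N.
    rewrite (bigD1 (Ordinal ltir)) //= [X in (_ < X)%N](bigD1 (Ordinal ltir)) //=.
    by rewrite -addSn leq_add // leq_sum // => k _; apply: J_gt0.
  by rewrite sum1_card card_ord ltnNge sumJ.
have [/existsP[j Jj]|noJ] := boolP [exists j : 'I_r, jump N (H j) (H j.+1) i]; last first.
  move: J1; rewrite /J big1 // => j _; move: noJ; rewrite negb_exists => /forallP/(_ j).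
  by move/negPf->.
have uniqJ k : k < r -> jump N (H k) (H k.+1) i -> k = j.
  move=> ltkr Jk; apply/eqP; have [//|nekj] := eqVneq k j.
  move: J1; rewrite /J (bigD1 j) //= Jj (bigD1 (Ordinal ltkr)) //= Jk.
  by rewrite !add1n.
exists (H j), (H j.+1); split=> //.
- exact: maxH.
- exact: HG.
- apply/negP=> Jk; have [|||k /andP[_ ltkj] Jk'] := @jump_path H i 0 j _ _ _ Jk => //.
  + by move=> k ltkj; apply: HS; apply: ltn_trans (ltn_ord j).
  + by apply: HG; apply: ltnW.
  by have := uniqJ k (ltn_trans ltkj (ltn_ord j)) Jk' => E; rewrite E ltnn in ltkj.
rewrite -Hr; apply/negP=> Jk.
have [|||k /andP[ltjk ltkr] Jk'] := @jump_path H i j.+1 r _ _ _ Jk => //.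
  by rewrite Hr.
by have := uniqJ k ltkr Jk' => E; rewrite E ltnn in ltjk.
Qed.

(** Let the step from [K] to [L] jump over [i]. Modulo [N i], [K] is a maximal complement of
    [N i.+1] in their product. Since [K] meets [N i] and [N i.+1] equally, [K / N i] embeds in
    [G / N i.+1] and is solvable, so the factor is solvable too. *)
Lemma solvable_chief_quotient i : i < r -> has_saturated_chain 1%G G r ->
  solvable (G / N i.+1) -> solvable (G / N i).
Proof.
move=> ltir satG solG; have [K [L [maxK sLG JK JKL JL]]] := unique_jump ltir satG.
have /maxgroupP[ltKL maxKP] := maxK; have sKL := proper_sub ltKL.
have sKG := subset_trans sKL sLG; have sNi := NS i.
have nMG := normal_norm (nNG i); have nNG' := normal_norm (nNG i.+1).
have sN'G := normal_sub (nNG i.+1).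
have nMK := subset_trans sKG nMG; have nMN := subset_trans sN'G nMG.
rewrite jump_bottom negbK in JK; rewrite negbK in JL.
have sLKN : L \subset K <*> N i.+1.
  apply: contraR JKL => nsL; have -> : K <*> N i.+1 :&: L = K; last exact: joing_subl.
  apply: (maxKP (K <*> N i.+1 :&: L)%G); last by rewrite subsetI joing_subl.
  rewrite properE subsetIr; apply: contra nsL => /subset_trans; apply; exact: subsetIl.
have nsLKM : ~~ (L \subset K <*> N i).
  by apply: contra JKL => sL; apply: subset_trans (subsetIr _ _) sL.
have eqLM : L <*> N i = K <*> N i.+1.
  apply/eqP; rewrite eqEsubset !join_subG sLKN (subset_trans sNi (joing_subr _ _)) /=.
  rewrite (subset_trans sKL (joing_subl _ _)) (subset_trans _ JL) //.
  by rewrite subsetI joing_subr.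
have maxKM : maximal (K <*> N i) (K <*> N i.+1).
  apply/maxgroupP; split=> [|X].
    rewrite properE genS ?setUS //=; apply: contra nsLKM; exact: subset_trans.
  rewrite -eqLM => ltX; rewrite join_subG => /andP[sKX sMX].
  have eqXL : X :&: L = K.
    apply: (maxKP (X :&: L)%G); last by rewrite subsetI sKX.
    rewrite properE subsetIr; apply: contraL ltX; rewrite subsetI subxx andbT => sLX.
    by rewrite properE negb_and negbK join_subG sLX sMX orbT.
  apply/eqP; rewrite eqEsubset join_subG sKX sMX !andbT; apply/subsetP=> x Xx.
  have [l [m [Ll Mm Ex]]] := mem_join_normal nNG sLG (subsetP (proper_sub ltX) x Xx).
  rewrite Ex groupM ?(subsetP (joing_subr _ _) m) // (subsetP (joing_subl _ _)) //.
  rewrite -eqXL inE Ll andbT; have -> : l = x * m^-1 by rewrite Ex mulgK.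
  by rewrite groupM // groupV (subsetP sMX).
have tiq : K / N i :&: N i.+1 / N i = 1.
  have sI : K :&: N i.+1 \subset N i by rewrite setIC.
  by rewrite -quotientIG //; apply: quotientS1 sI.
have solN : solvable (N i.+1 / N i).
  apply: (@solvable_maximal_complement _ (K / N i)%G) => //=.
  - by rewrite quotient_norms // (subset_trans sKG).
  - rewrite -quotientY // -(quotientYidr nMK) quotient_maximal //.
      by rewrite /normal joing_subr join_subG nMK normG.
    by rewrite /normal join_subG nMK nMN (subset_trans sNi) ?joing_subr.
  have eqI : N i :&: K = N i.+1 :&: K.
    by apply/eqP; rewrite eqEsubset setSI //= subsetI JK subsetIr.
  rewrite -(isog_sol (second_isog nMK)) eqI (isog_sol (second_isog _)).
    exact: solvableS (quotientS _ sKG) solG.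
  exact: subset_trans sKG nNG'.
rewrite (series_sol (quotient_normal (N i) (nNG i.+1))) solN /=.
by rewrite (isog_sol (third_isog sNi (nNG i) (nNG i.+1))).
Qed.

Theorem solvable_short_saturated_chain : has_saturated_chain 1%G G r -> solvable G.
Proof.
move=> satG; have solQ k : k <= r -> solvable (G / N (r - k)).
  elim: k => [|k IHk] ltkr; first by rewrite subn0 Nr trivg_quotient solvable1.
  apply: solvable_chief_quotient => //; first by lia.
  by rewrite (_ : (r - k.+1).+1 = r - k)%N; [apply: IHk; apply: ltnW | lia].
have := solQ r (leqnn r); rewrite subnn N0.
by rewrite -(isog_sol (quotient1_isog G)).
Qed.

End ShortSaturatedChain.

(** * Kohler's theorem on short saturated chains of solvable groups *)

Section KohlerChain.

Implicit Types gT : finGroupType.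

Definition no_normal_between gT (G A B : {group gT}) :=
  forall X : {group gT}, X <| G -> A \subset X -> X \subset B -> X :=: A \/ X :=: B.

(** The product of [A] with the derived subgroup of [B] is normal in [G] and lies between; were it
    [B], the quotient [B / A] would be perfect, hence trivial by solvability. *)
Lemma solvable_irreducible_der1 gT (G A B : {group gT}) :
    solvable G -> A <| G -> B <| G -> A \subset B -> no_normal_between G A B ->
  B^`(1) \subset A.
Proof.
move=> solG nsA nsB sAB irr; have [sBG nBG] := andP nsB; have [sAG nAG] := andP nsA.
have sB'B : B^`(1) \subset B := der_sub 1 B.
have nAB := subset_trans sBG nAG.
have [||/= <-|defB] := irr (B^`(1) <*> A)%G _ (joing_subr _ _).
- by apply: normalY nsA; apply: char_normal_trans (der_char 1 B) nsB.
- by rewrite join_subG sB'B.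
- exact: joing_subl.
have [AB1|ntBA] := eqVneq (B / A) 1.
  by apply: subset_trans sB'B _; rewrite -quotient_sub1 ?AB1.
have := sol_der1_proper (quotient_sol A solG) (quotientS A sBG) ntBA.
rewrite -quotient_der // -(quotientYidr (subset_trans sB'B nAB)) defB.
by rewrite properxx.
Qed.

(* Frattini's argument, twice: a Sylow subgroup P of B satisfies G = B 'N_G(P), so
   PA is normal in G, whence G = A 'N_G(P) = 'N_G(P). *)
Lemma nilpotent_mod_Frattini gT (G A B : {group gT}) :
    A <| G -> B <| G -> A \subset B -> B^`(1) \subset A ->
    (forall M : {group gT}, maximal M G -> A \subset M) ->
  nilpotent B.
Proof.
move=> nsA nsB sAB sB'A maxA; have [sBG nBG] := andP nsB; have [sAG nAG] := andP nsA.
suffices sylF p (P : {group gT}) : p.-Sylow(B) P -> P \subset 'F(B).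
  apply: nilpotentS (Fitting_nil B); rewrite -{1}(Sylow_gen B) gen_subG.
  by apply/bigcupsP=> P /SylowP[p _ /sylF].
move=> sylP; have /and3P[sPB pP _] := sylP.
have sPAB : P <*> A \subset B by rewrite join_subG sPB.
have nPAG : P <*> A <| G.
  rewrite /normal (subset_trans sPAB sBG) /= -(Frattini_arg nsB sylP) mul_subG //.
    by apply: sub_der1_norm sPAB; apply: subset_trans sB'A (joing_subr _ _).
  by rewrite normsY ?subsetIr // (subset_trans (subsetIl _ _) nAG).
have sylP' : p.-Sylow(P <*> A) P := pHall_subl (joing_subl P A) sPAB sylP.
have defG : P <*> A * 'N_G(P) = G := Frattini_arg nPAG sylP'.
have nPG : 'N_G(P) = G.
  have [//|[M maxM sNM]] := maximal_exists (subsetIl G 'N(P)).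
  have /andP[_ /negP[]] := maxgroupp maxM.
  rewrite -defG mul_subG // join_subG maxA // andbT.
  by rewrite (subset_trans _ sNM) // subsetI (subset_trans sPB sBG) normG.
apply: Fitting_max (pgroup_nil pP); rewrite /normal sPB (subset_trans sBG) //.
by rewrite -nPG subsetIr.
Qed.

(** If [[~: C, B] <*> A] were [C], then [C / A] would equal its commutator with the nilpotent
    [B / A], hence be trivial. *)
Lemma nilpotent_cent_irreducible gT (G A B C : {group gT}) :
    nilpotent B -> B <| G -> A <| G -> C <| G -> A \subset C -> C \subset B ->
    no_normal_between G A C ->
  [~: C, B] \subset A.
Proof.
move=> nilB nsB nsA nsC sAC sCB irr; have [sBG nBG] := andP nsB.
have [sAG nAG] := andP nsA; have [sCG nCG] := andP nsC.
have nAB := subset_trans sBG nAG; have nAC := subset_trans sCG nAG.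
have sRC : [~: C, B] \subset C by rewrite commg_subl (subset_trans sBG).
have [||/= <-|defC] := irr ([~: C, B] <*> A)%G _ (joing_subr _ _).
- apply: normalY nsA; rewrite /normal (subset_trans sRC sCG).
  by rewrite normsR.
- by rewrite join_subG sRC.
- exact: joing_subl.
apply: (subset_trans sRC); rewrite -quotient_sub1 // subG1.
have /forall_inP/(_ (C / A)%G) := quotient_nil A nilB; apply.
rewrite subsetI quotientS //= -quotientR // -(quotientYidr (subset_trans sRC nAC)).
by rewrite defC.
Qed.

(* Kohler's theorem.  The terms and the factors of the series may repeat, so that
   intersecting it with a maximal subgroup does not require reindexing. *)
Theorem solvable_saturated_chain gT (G : {group gT}) (N : nat -> {group gT}) (r : nat) :
    solvable G -> N 0 :=: 1 -> N r :=: G -> (forall i, N i <| G) ->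
    (forall i, N i \subset N i.+1) -> (forall i, no_normal_between G (N i) (N i.+1)) ->
  exists2 n, n <= \sum_(i < r) (N i != N i.+1) & has_saturated_chain 1%G G n.
Proof.
have [m] := ubnP #|G|; elim: m G N => // m IHm G N; rewrite ltnS => leGm.
move=> solG N0 Nr nsN NS irr.
have [G1|ntG] := eqVneq (G : {set gT}) 1.
  exists 0 => //; apply/has_saturated_chainP; exists [::]; split=> //=.
  by apply: val_inj; rewrite /= G1.
have mono : forall i j, i <= j -> N i \subset N j := normal_chain_mono NS.
(* [p i] says that [N i] is not in the Frattini subgroup of [G]; the least such index locates a
   factor complemented by a maximal subgroup. *)
pose p i := [exists M : {group gT}, maximal M G && ~~ (N i \subset M)].
have ex_p : exists i, p i.
  have [/eqP|[M maxM _]] := maximal_exists (sub1G G); first by rewrite eq_sym (negPf ntG).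
  exists r; apply/existsP; exists M; rewrite maxM Nr.
  by case/andP: (maxgroupp maxM).
have p_r : p r.
  by case: ex_p => i /existsP[M /andP[maxM _]]; apply/existsP; exists M; rewrite maxM Nr;
     case/andP: (maxgroupp maxM).
case: (ex_minnP ex_p) => -[|i] /existsP[M /andP[maxM nsM]] min_i.
  by rewrite N0 sub1G in nsM.
have ltir : i < r by apply: min_i.
have NM (K : {group gT}) : maximal K G -> N i \subset K.
  move=> maxK; apply/negPn/negP=> nsK; have /min_i : p i by apply/existsP; exists K; rewrite maxK.
  by rewrite ltnn.
have ltMG := maxgroupp maxM; have sMG := proper_sub ltMG.
have [sBG nBG] := andP (nsN i.+1).
have sB'A : (N i.+1)^`(1) \subset N i by apply: (@solvable_irreducible_der1 _ G).
have nilB : nilpotent (N i.+1) by apply: (nilpotent_mod_Frattini (nsN i) _ (NS i) sB'A NM).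
have nBM := subset_trans sMG nBG.
have defG : M <*> N i.+1 = G.
  have sMB : M <*> N i.+1 \subset G by rewrite join_subG sMG.
  apply/eqP; rewrite eqEproper sMB /=; apply/negP=> ltMB.
  case/maxgroupP: maxM => _ /(_ (M <*> N i.+1)%G ltMB (joing_subl _ _)) /= E.
  by case/negP: nsM; rewrite -E joing_subr.
have normG_ (X : {group gT}) : X \subset G -> M \subset 'N(X) -> N i.+1 \subset 'N(X) -> X <| G.
  by move=> sXG nXM nXB; rewrite /normal sXG -defG join_subG nXM.
have tiMB : N i.+1 :&: M = N i.
  have [|||//|E] := irr i (N i.+1 :&: M)%G; last by case/negP: nsM; rewrite -E subsetIr.
  - apply: normG_; first exact: subset_trans (subsetIr _ _) sMG.
      by rewrite normsI // normG.
    by apply: sub_der1_norm (subsetIl _ _); rewrite (subset_trans sB'A) // subsetI NS NM.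
  - by rewrite subsetI NS NM.
  exact: subsetIl.
pose N' j := (N j :&: M)%G.
have irr' j : no_normal_between M (N' j) (N' j.+1).
  move=> X /andP[sXM nXM] sNX sXN; have sXG := subset_trans sXM sMG.
  have [ltji|ltij|eqij] := ltngtP j i.
  - have sjM : N j.+1 \subset M := subset_trans (mono _ _ ltji) (NM _ maxM).
    have E1 : N' j :=: N j by apply/setIidPl; apply: subset_trans sjM.
    have E2 : N' j.+1 :=: N j.+1 by apply/setIidPl.
    rewrite E1 E2 in sNX sXN *; apply: (irr j) => //; apply: normG_ => //.
    (* The nilpotent group [N i.+1] centralises [N j.+1 / N j], so it normalises [X]. *)
    rewrite -commg_subl (subset_trans _ sNX) // (subset_trans (commSg _ sXN)) //.
    apply: (@nilpotent_cent_irreducible _ G) => //.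
    exact: mono (leqW ltji).
  (* Above [i], the group [X <*> N i.+1] is normal in [G], and intersecting it with [M] recovers
     [X]. *)
  - have sBj : N i.+1 \subset N j := mono _ _ ltij.
    have nXBG : (X <*> N i.+1)%G <| G.
      apply: normG_; first by rewrite join_subG sXG.
        by rewrite normsY.
      exact: subset_trans (joing_subr _ _) (normG _).
    have defX : X <*> N i.+1 :&: M = X.
      apply/eqP; rewrite eqEsubset [X in _ && X]subsetI joing_subl sXM andbT.
      rewrite norm_joinEl ?(subset_trans sXM) // -group_modl // mul_subG // tiMB.
      by rewrite (subset_trans _ sNX) // subsetI (subset_trans (NS i) sBj) NM.
    have [|||/= E|/= E] := irr j (X <*> N i.+1)%G => //=.
    + apply/subsetP=> x Nx; have : x \in M * N i.+1.
        by rewrite -norm_joinEl // defG (subsetP (normal_sub (nsN j))).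
      case/mulsgP=> y b My Bb Ex; rewrite Ex groupM ?(subsetP (joing_subr _ _) b) //.
      apply: (subsetP (joing_subl _ _)); apply: (subsetP sNX); rewrite inE My andbT.
      have -> : y = x * b^-1 by rewrite Ex mulgK.
      by rewrite groupM // groupV (subsetP sBj).
    + rewrite join_subG (subset_trans sXN (subsetIl _ _)).
      exact: subset_trans sBj (NS j).
    + by left; rewrite /= -E.
    + by right; rewrite /= -E.
  by left; apply/eqP; rewrite eqEsubset sNX andbT (subset_trans sXN) //= eqij tiMB subsetI subxx NM.
have [|||||||n le_n sat_n] := IHm M N' => //.
- exact: leq_trans (proper_card ltMG) leGm.
- exact: solvableS sMG solG.
- by rewrite /= N0; apply/trivgP; apply: subsetIl.
- by rewrite /= Nr; apply/setIidPr.
- by move=> j; rewrite /normal subsetIr normsI ?normG // (subset_trans sMG) // normal_norm.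
- by move=> j; apply: setSI.
exists n.+1; last first.
  by rewrite -addn1; apply: has_saturated_chain_cat sat_n (has_saturated_chain1 maxM).
apply: leq_ltn_trans le_n _.
rewrite (bigD1 (Ordinal ltir)) //= [X in (_ < X)%N](bigD1 (Ordinal ltir)) //=.
(* The factor at [i] collapses in [M], which pays for the last step from [M] to [G]. *)
have -> : N' i = N' i.+1.
  by apply: val_inj; rewrite /= tiMB; apply/setIidPl; apply: NM.
have -> : N i != N i.+1.
  by apply: contraNneq nsM => <-; apply: NM.
rewrite eqxx add0n add1n ltnS; apply: leq_sum => j _.
by have [E|_] := eqVneq (N j) (N j.+1); rewrite ?leq_b1 // /N' E eqxx.
Qed.

End KohlerChain.

(** * Facets from saturated chains, and the equivalence *)

Lemma subgroup_complexE (gT : finGroupType) (G : {group gT}) :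
  subgroup_complex G = order_complex (@subgroup_le gT) (open_itv 1%G G).
Proof.
congr (order_complex _ _); apply/setP=> X; rewrite !inE negb_or proper1G.
rewrite [X \proper G]properEneq -andbA; congr (_ && _).
Qed.

Lemma chief_series_fun (gT : finGroupType) (G : {group gT}) r :
  has_chief_series G r ->
  exists N : nat -> {group gT},
    [/\ N 0 :=: 1, N r :=: G, forall i, N i <| G, forall i, i < r -> N i \proper N i.+1
      & forall i, N i \subset N i.+1 /\ no_normal_between G (N i) (N i.+1)].
Proof.
(* The default value [G] makes the series constant from [r] on, so normality and irreducibility hold
   at every index. *)
case=> s [ps ls ss]; pose N i : {group gT} := nth G (1%G :: s) i.
have chief i : i < r -> chief_factor G (N i) (N i.+1).
  by rewrite -ss => ltir; have /(pathP G)/(_ i ltir) := ps.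
have Nr : N r = G by rewrite /N -ss -last_nth.
have N_ge i : r <= i -> N i = G.
  rewrite leq_eqVlt => /predU1P[<- //|]; rewrite -ss; case: i => // i lt_si.
  by rewrite /N /= nth_default.
have nsN i : N i <| G.
  have [/N_ge->|] := leqP r i; first exact: normal_refl.
  case: i => [|i] ltir; first exact: normal1.
  by have /andP[] := chief i (ltnW ltir).
have ltN i : i < r -> N i \proper N i.+1.
  by move/chief/andP=> [/maxgroupp/andP[]].
have NS i : N i \subset N i.+1.
  have [leri|/ltN/proper_sub//] := leqP r i.
  by rewrite !N_ge // leqW.
exists N; split=> //; first by rewrite Nr.
move=> i; split=> // X nsX sNX sXN.
have [leri|/chief/andP[/maxgroupP[_ maxN] _]] := leqP r i.
  by left; apply/eqP; rewrite eqEsubset sNX andbT (subset_trans sXN) // !N_ge // leqW.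
have [->|neX] := eqVneq (X : {set gT}) (N i.+1); [by right | left].
by apply: maxN => //; rewrite properEneq neX sXN normal_norm.
Qed.

(** Going up the chain, [X] falls between two consecutive members, and maximality makes it one of
    them. *)
Lemma saturated_chain_maximal (gT : finGroupType) (A X : {group gT}) t :
    path (@maximal_in gT) A t -> A \subset X -> X \subset last A t ->
    (forall Y : {group gT}, Y \in t -> (X \subset Y) || (Y \subset X)) ->
  X \in A :: t.
Proof.
elim: t A => [|B t IHt] A /=.
  by move=> _ sAX sXA _; rewrite inE -val_eqE eqEsubset sXA.
case/andP=> /maxgroupP[_ maxA] pt sAX sXt cX.
case/orP: (cX B (mem_head _ _)) => [sXB|sBX]; last first.
  by rewrite inE (IHt B) ?orbT // => Y tY; apply: cX; rewrite inE tY orbT.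
have [eqXB|neXB] := eqVneq X B; first by rewrite eqXB inE mem_head orbT.
rewrite inE -val_eqE /= (maxA X) ?eqxx //.
by rewrite properEneq sXB andbT.
Qed.

Lemma saturated_chain_sub_last (gT : finGroupType) (A X : {group gT}) t :
  path (@maximal_in gT) A t -> X \in A :: t -> X \subset last A t.
Proof.
elim: t A X => [|B t IHt] A X /=; first by rewrite inE => _ /eqP->.
case/andP=> maxA pt; rewrite inE => /predU1P[->|/(IHt _ _ pt)//].
exact: subset_trans (proper_sub (maxgroupp maxA)) (IHt _ _ pt (mem_head _ _)).
Qed.

Lemma saturated_chain_facet (gT : finGroupType) (G : {group gT}) (n r : nat) :
    G :!=: 1 -> n <= r -> has_saturated_chain 1%G G n ->
  exists2 c, c \in facets (skeleton (r%:Z - 1)%R (subgroup_complex G)) & #|c| < n.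
Proof.
move=> ntG le_nr /has_saturated_chainP[t [pt last_t st]].
have tG : G \in t.
  case: t pt last_t {st} => [|B t] /= _ E; last by rewrite -E mem_last.
  by move: ntG; rewrite -E eqxx.
(* [t] omits the trivial group but contains [G], so dropping [G] leaves fewer than [n] vertices. *)
pose c := [set X in t] :\ G; have ct : #|c| < n.
  rewrite -st (leq_trans _ (card_size t)) // -(cardsE (mem t)).
  by rewrite [X in _ < X](cardsD1 G) inE tG.
exists c => //; rewrite subgroup_complexE inE; apply/maxsetP.
pose lt : rel {group gT} := fun X Y => X \proper Y.
have lt_trans : transitive lt by move=> Y X Z; apply: proper_trans.
have : path lt 1%G t by apply: sub_path pt => X Y; apply: maxgroupp.
rewrite (path_sortedE lt_trans) => /andP[/allP lt1 sort_t].
split.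
  apply/mem_skeleton; split; last by rewrite (leq_trans (ltnW ct)).
    apply/subsetP=> X; rewrite !inE => /andP[neXG tX]; rewrite [_ \proper _]lt1 // properEneq.
    by rewrite [X :!=: G]neXG -last_t saturated_chain_sub_last // inE tX orbT.
  move=> X Y /setD1P[_]; rewrite inE => tX /setD1P[_]; rewrite inE => tY.
  rewrite /comparable_by /subgroup_le.
  have [ltXY|ltYX|eqXY] := ltngtP (index X t) (index Y t).
  - by rewrite proper_sub //; apply: (sorted_ltn_index lt_trans sort_t).
  - by rewrite orbC proper_sub //; apply: (sorted_ltn_index lt_trans sort_t).
  by rewrite (index_inj X tX tY eqXY) subxx.
move=> f /mem_skeleton[/subsetP sf clf _] sc; apply/eqP; rewrite eqEsubset sc andbT.
apply/subsetP=> X fX; have := sf X fX; rewrite !inE => /andP[lt1X ltXG].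
have neXG : X != G by apply: contraTneq ltXG => ->; rewrite properxx.
have neX1 : X != 1%G by apply: contraTneq lt1X => ->; rewrite properxx.
have := @saturated_chain_maximal _ 1%G X t pt (sub1G X).
rewrite inE (negPf neX1) neXG; apply; first by rewrite last_t proper_sub.
move=> Y tY; have [->|neYG] := eqVneq Y G; first by rewrite proper_sub.
by apply: clf => //; apply: (subsetP sc); rewrite !inE neYG.
Qed.

Local Close Scope group_scope.

(* The trivial group (r = 0) must be excluded: it is solvable, while its
   complex, whose only face is the empty one, is shellable and pure of
   dimension -1. *)
Theorem theorem1p2 (gT : finGroupType) (G : {group gT}) (r : nat)
    (ntG : G :!=: 1%g) (chG : has_chief_series G r) :
  ~~ solvable G <->
  shellable (skeleton (r%:Z - 1)%R (subgroup_complex G)) /\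
  pure_of_dim (r%:Z - 1)%R (skeleton (r%:Z - 1)%R (subgroup_complex G)).
Proof.
have [N [N0 Nr nsN ltN NSirr]] := chief_series_fun chG.
have NS i : N i \subset N i.+1 by case: (NSirr i).
have irr i : no_normal_between G (N i) (N i.+1) by case: (NSirr i).
split=> [nsolG|[_ [_ pureG]]].
  have satG : ~~ has_saturated_chain 1%G G r.
    by apply: contra nsolG; apply: (solvable_short_saturated_chain nsN N0 Nr NS ltN).
  have lt1G : 1%G \proper G by rewrite proper1G.
  have [SG _] := skel_dec_open_itv_and_non_supplements r nsN NS lt1G (subxx G).
  (* The bound [r] is not attained, so the depth is [r + 1] and its predecessor gives faces of [r]
     vertices, that is, dimension [r - 1]. *)
  rewrite /itv_depth (njump_full nsN ltN) satG addn1 /= in SG.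
  have le_refl : reflexive (@subgroup_le gT) by move=> X; apply: subxx.
  rewrite subgroup_complexE.
  by split; [apply: skel_dec_shellable | apply: skel_dec_pure_of_dim].
apply/negP=> solG.
have [n le_n sat_n] := solvable_saturated_chain solG N0 Nr nsN NS irr.
have le_nr : n <= r.
  by apply: leq_trans le_n _; rewrite -[X in _ <= X]card_ord -sum1_card leq_sum // => i _; case: eqP.
have [c facet_c ltcn] := saturated_chain_facet ntG le_nr sat_n.
have := pureG c facet_c; rewrite /sdim; lia.
Qed.
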